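(* Let $p$ be a prime, $q=p^e$, $m,k\ge1$, and let $f\in\mathbb{F}_{q^m}[x_1,\dots,x_k]$ be a polynomial of degree $d\ge1$. Then \[\nu_p\big(N(f=y^q-y)\big)\ge e\Big\lceil\frac{mk}{W_q(d,\mathbb{F}_{q^m}^k)}\Big\rceil,\] where $W_q(d,\mathbb{F}_{q^m}^k)=\max\{S_q(\boldsymbol{t}):\boldsymbol{t}\in[0,q^m-1]^k,\ |\boldsymbol{t}|\le d\}$.
   Context: $N(f=y^q-y)$ denotes the number of $(x_1,\dots,x_k,y)\in\mathbb{F}_{q^m}^{k+1}$ with $f(x_1,\dots,x_k)=y^q-y$; $\nu_p$ is the $p$-adic valuation. For $\boldsymbol{t}=(t_1,\dots,t_k)$, $|\boldsymbol{t}|=\sum t_i$ and $S_q(\boldsymbol{t})=\sum_i S_q(t_i)$, where $S_q(a)$ is the sum of the base-$q$ digits of $a$. *)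

(* Defs.v *)
From HB Require Import structures.
From mathcomp Require Import all_boot all_order all_algebra all_field.
From mathcomp Require Import mpoly.
Set Implicit Arguments. Unset Strict Implicit. Unset Printing Implicit Defensive.
Import GRing.Theory.
Local Open Scope ring_scope.

(* sum of base-q digits of n (fuel n suffices for q >= 2) *)
Fixpoint digsum_aux (fuel q n : nat) : nat :=
  match fuel with
  | 0 => 0
  | fuel'.+1 => if n == 0%N then 0 else (n %% q + digsum_aux fuel' q (n %/ q))%N
  end.
Definition digsum (q n : nat) : nat := digsum_aux n q n.

(* W_q(d, F_{Q}^k) with Q = q^m = |F|: max of S_q(t) over t in [0,Q-1]^k, |t| <= d *)
Definition Wq (q Q k d : nat) : nat :=
  (\max_(t : {ffun 'I_k -> 'I_Q} | (\sum_(i < k) (t i : nat) <= d)%N)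
      \sum_(i < k) digsum q (t i))%N.

Definition ceil_div (a b : nat) : nat := ((a + b).-1 %/ b)%N.

Definition Nsol (F : finFieldType) (k q : nat) (f : {mpoly F[k]}) : nat :=
  #|[set xy : {ffun 'I_k -> F} * F | f.@[xy.1] == xy.2 ^+ q - xy.2]|.

(* Main.v *)
(* Let [Q = q ^ m].  The map [y |-> y ^ q - y] is [q]-to-1 onto the trace zero
   elements of F, so the count is [q * Z] with [Z] the number of zeros of
   [Tr f].  Lift F to a ring R with [R / p = F] and [Tr f] to
   [G(x) = sum_(i,l) M_(i,l)(x)], where [M_(i,l)] lifts the [q^l]-th power of
   the i-th monomial of f and is evaluated at Teichmuller points.  Since [Tr f]
   takes values in F_q, [Z] is congruent to [sum_x (1 - G(x) ^ ((q - 1) p ^ b))]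
   modulo [p ^ b].  In the multinomial expansion, the coefficient of
   [prod M_(i,l) ^ j_(i,l)] has p-adic valuation
   [(sum s_p(j_(i,l))) / (p - 1) - e] by Legendre's formula, and summing over x
   kills it unless the total exponent [E_c] of every variable [x_c] is divisible
   by [Q - 1].  Then each nonzero [E_c] has [S_q(p^r E_c) >= m (q - 1)], and
   [S_q] is subadditive and submultiplicative; averaging over the digit shifts
   [r < e] turns this into a lower bound for [sum s_p(j_(i,l))].  The multinomial
   coefficients thus play the part of the Gauss sums in Ax's argument. *)
Require Import Defs.
From mathcomp Require Import all_boot all_order all_algebra all_field.
From mathcomp Require Import mpoly.
From mathcomp Require Import cyclic zify ring.
Set Implicit Arguments. Unset Strict Implicit. Unset Printing Implicit Defensive.
Import GRing.Theory.

(** * Digit sums *)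

Lemma digsum_auxE fuel q n : 1 < q -> n <= fuel -> digsum_aux fuel q n = digsum q n.
Proof.
move=> q1; rewrite /digsum.
elim/ltn_ind: n fuel => -[|n] IHn [|f] //= nf.
have lt_n : n.+1 %/ q < n.+1 by apply: ltn_Pdiv.
by rewrite !(IHn (n.+1 %/ q)) //; lia.
Qed.

Lemma digsumE q n : 1 < q -> digsum q n = n %% q + digsum q (n %/ q).
Proof.
move=> q1; case: n => [|n]; first by rewrite mod0n div0n.
have lt_n : n.+1 %/ q < n.+1 by apply: ltn_Pdiv.
by rewrite {1}/digsum /= digsum_auxE //; lia.
Qed.

Lemma digsumMD q a r : 1 < q -> r < q -> digsum q (a * q + r) = digsum q a + r.
Proof.
move=> q1 rq; rewrite digsumE // modnMDl modn_small // divnMDl; last by lia.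
by rewrite divn_small // addn0 addnC.
Qed.

Lemma digsum_small q r : 1 < q -> r < q -> digsum q r = r.
Proof. by move=> q1 rq; have := digsumMD 0 q1 rq. Qed.

Lemma digsumXM q l a : 1 < q -> digsum q (q ^ l * a) = digsum q a.
Proof.
move=> q1; elim: l => [|l IHl]; first by rewrite mul1n.
by rewrite expnS -mulnA mulnC -[_ * q]addn0 digsumMD ?addn0 //; lia.
Qed.

Lemma digsum_modn q n : 1 < q -> digsum q n = n %[mod q.-1].
Proof.
move=> q1; elim/ltn_ind: n => n IHn; rewrite digsumE //.
case: n IHn => [|n] IHn; first by rewrite mod0n div0n.
have lt_n : n.+1 %/ q < n.+1 by apply: ltn_Pdiv.
have e_n : n.+1 = n.+1 %/ q * q.-1 + (n.+1 %% q + n.+1 %/ q).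
  by rewrite addnCA -mulnSr prednK 1?ltnW // addnC -divn_eq.
by rewrite -modnDmr IHn // modnDmr [in RHS]e_n modnMDl.
Qed.

Lemma digsumS q n : 1 < q -> digsum q n.+1 <= (digsum q n).+1.
Proof.
move=> q1; elim/ltn_ind: n => n IHn.
have rq : n %% q < q by rewrite ltn_mod; lia.
rewrite (digsumE n) // {1}(divn_eq n q) -addnS.
have [r1q|ge_r] := ltnP (n %% q).+1 q; first by rewrite digsumMD //; lia.
have e_r : (n %% q).+1 = q by lia.
rewrite e_r -mulSnr -[_ * q]addn0 digsumMD ?addn0; try lia.
case: n IHn e_r {rq ge_r} => [|n] IHn e_r; first by rewrite mod0n in e_r; lia.
have := IHn (n.+1 %/ q) (ltn_Pdiv q1 (ltn0Sn n)); lia.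
Qed.

Lemma digsumD q a b : 1 < q -> digsum q (a + b) <= digsum q a + digsum q b.
Proof.
move=> q1; elim/ltn_ind: a b => a IHa b.
case: a IHa => [|a] IHa //.
have lt_a : a.+1 %/ q < a.+1 by apply: ltn_Pdiv.
have {IHa} := IHa _ lt_a (b %/ q); move: (a.+1) => {lt_a}a IHa.
have ra : a %% q < q by rewrite ltn_mod; lia.
have rb : b %% q < q by rewrite ltn_mod; lia.
have -> : a + b = (a %/ q + b %/ q) * q + (a %% q + b %% q).
  by rewrite {1}(divn_eq a q) {1}(divn_eq b q) mulnDl; lia.
rewrite (digsumE a) // (digsumE b) //.
have [lt_q|ge_q] := ltnP (a %% q + b %% q) q; first by rewrite digsumMD //; lia.
rewrite -(subnK ge_q) [_ - q + q]addnC addnA -mulSnr digsumMD //; last by lia.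
by have := digsumS (a %/ q + b %/ q) q1; lia.
Qed.

Lemma digsum_sum q (I : Type) (r : seq I) (E : I -> nat) : 1 < q ->
  digsum q (\sum_(i <- r) E i) <= \sum_(i <- r) digsum q (E i).
Proof.
move=> q1; elim/big_rec2: _ => // i y1 y2 _ IH.
by apply: leq_trans (digsumD _ _ q1) _; rewrite leq_add2l.
Qed.

Lemma digsum_muln q r b : 1 < q -> digsum q (r * b) <= r * digsum q b.
Proof.
move=> q1; elim: r => // r IHr; rewrite !mulSn.
by apply: leq_trans (digsumD _ _ q1) _; rewrite leq_add2l.
Qed.

(** Schoolbook multiplication: each base-[q] digit [r] of [a] contributes a shifted copy of
    [r * b]. *)
Lemma digsumM q a b : 1 < q -> digsum q (a * b) <= digsum q a * digsum q b.
Proof.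
move=> q1; elim/ltn_ind: a => -[|a] IHa //.
have {IHa} := IHa _ (ltn_Pdiv q1 (ltn0Sn a)); move: (a.+1) => {}a IHa.
rewrite {1}(divn_eq a q) mulnDl (digsumE a) // mulnDl addnC.
apply: leq_trans (digsumD _ _ q1) _; apply: leq_add; first exact: digsum_muln.
by rewrite mulnAC mulnC -{2}(expn1 q) digsumXM.
Qed.

Lemma digsum_divn_modn q m n : 1 < q ->
  digsum q n = digsum q (n %/ q ^ m) + digsum q (n %% q ^ m).
Proof.
move=> q1; elim: m n => [|m IHm] n; first by rewrite divn1 modn1 addn0.
rewrite digsumE // IHm -divnMA -expnS.
rewrite [in RHS](digsumE (n %% _)) //.
have -> : n %% q ^ m.+1 %% q = n %% q by rewrite modn_dvdm // expnS dvdn_mulr.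
have -> : n %% q ^ m.+1 %/ q = (n %/ q) %% q ^ m by rewrite modn_divl -expnSr.
lia.
Qed.

Lemma digsum_predX q m : 1 < q -> digsum q (q ^ m).-1 = m * q.-1.
Proof.
move=> q1; elim: m => // m IHm.
have q_gt0 : 0 < q ^ m by rewrite expn_gt0; lia.
have -> : (q ^ m.+1).-1 = (q ^ m).-1 * q + q.-1.
  by rewrite expnSr -{1}(prednK q_gt0) mulSn; lia.
by rewrite digsumMD ?IHm //; lia.
Qed.

(** Since [q ^ m] is 1 modulo [q ^ m - 1], adding the part of [n] above its lowest [m] digits to
    those digits keeps divisibility and positivity, lowers [n] and does not raise the digit sum. The
    descent ends at [q ^ m - 1]. *)
Lemma leq_digsum_dvdn q m n : 1 < q -> 0 < m -> 0 < n -> (q ^ m).-1 %| n ->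
  m * q.-1 <= digsum q n.
Proof.
move=> q1 m0; elim/ltn_ind: n => n IHn n0 dvd_n.
have Q1 : 1 < q ^ m by rewrite -[1](exp1n m) ltn_exp2r.
have [lt_n|ge_n] := ltnP n (q ^ m).
  rewrite -digsum_predX //; have -> // : n = (q ^ m).-1.
  by apply/eqP; rewrite eqn_leq (dvdn_leq n0 dvd_n) andbT; lia.
have a0 : 0 < n %/ q ^ m by rewrite divn_gt0 //; lia.
rewrite (digsum_divn_modn m n q1); apply: leq_trans (digsumD _ _ q1).
apply: IHn; first 1 last.
- by rewrite addn_gt0 a0.
- have e_n : n = n %/ q ^ m * (q ^ m).-1 + (n %/ q ^ m + n %% q ^ m).
    by rewrite addnA -mulnSr (prednK (ltnW Q1)) -divn_eq.
  by move: dvd_n; rewrite {1}e_n dvdn_addr // dvdn_mull.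
rewrite {3}(divn_eq n (q ^ m)) ltn_add2r -{1}[_ %/ _]muln1 ltn_pmul2l //.
Qed.

Lemma sum_expn_pred p e : 0 < p -> (\sum_(r < e) p ^ r) * p.-1 = (p ^ e).-1.
Proof. by move=> p0; rewrite predn_exp mulnC. Qed.

(** Over the [e] shifts, a base-[p] digit takes each weight [p ^ r] with [r < e] once inside a
    base-[p ^ e] digit; these weights add up to [(p ^ e - 1) / (p - 1)]. *)
Lemma sum_digsum_shift p e j : 1 < p -> 0 < e ->
  p.-1 * (\sum_(r < e) digsum (p ^ e) (p ^ r * j)) <= (p ^ e).-1 * digsum p j.
Proof.
move=> p1 e0; have q1 : 1 < p ^ e by rewrite -[1](exp1n e) ltn_exp2r.
elim/ltn_ind: j => -[|j] IHj.
  by rewrite big1 ?muln0 // => r _; rewrite muln0.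
have {IHj} := IHj _ (ltn_Pdiv p1 (ltn0Sn j)); move: (j.+1) => {}j IHj.
(* Multiplication by [p ^ e] keeps base-[p ^ e] digit sums, so the shifts by 1 to [e] and by 0 to
   [e - 1] give the same total. *)
have shift : \sum_(r < e) digsum (p ^ e) (p ^ r.+1 * (j %/ p))
             = \sum_(r < e) digsum (p ^ e) (p ^ r * (j %/ p)).
  case: e e0 q1 {IHj} => // e _ q1.
  rewrite big_ord_recr big_ord_recl /= addnC mul1n -{2}(expn1 (p ^ e.+1)).
  by rewrite digsumXM.
rewrite (digsumE j) // mulnDr addnC.
apply: (@leq_trans (p.-1 * (\sum_(r < e) digsum (p ^ e) (p ^ r.+1 * (j %/ p))
         + \sum_(r < e) j %% p * p ^ r))).
  rewrite leq_mul2l -big_split /=; apply/orP; right; apply: leq_sum => r _.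
  rewrite {1}(divn_eq j p) mulnDr mulnA mulnAC -expnSr [p ^ r * (_ %% _)]mulnC.
  apply: leq_trans (digsumD _ _ q1) _; rewrite leq_add2l.
  apply: leq_trans (digsum_muln _ _ q1) _.
  by rewrite digsum_small // ltn_exp2l.
rewrite mulnDr shift leq_add // -big_distrr /= mulnCA mulnC.
by rewrite [_.-1 * \sum_(_ < _) _]mulnC sum_expn_pred // ltnW.
Qed.

Lemma legendre_digsum p n : prime p -> p.-1 * logn p n`! + digsum p n = n.
Proof.
move=> p_pr; have p1 := prime_gt1 p_pr; rewrite logn_fact // big_add1 /=.
(* The cutoff [K] is decoupled from [n], so that the induction can pass to [n %/ p]. *)
suff {n} H K n : n <= K -> p.-1 * (\sum_(0 <= k < K) n %/ p ^ k.+1) + digsum p n = n.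
  exact: H.
elim: K n => [|K IHK] n; first by rewrite leqn0 => /eqP->; rewrite big_geq ?muln0.
case: n => [|n] leK; first by rewrite big1 ?muln0 // => i _; rewrite div0n.
have lt_n : n.+1 %/ p < n.+1 by apply: ltn_Pdiv.
have {IHK} := IHK (n.+1 %/ p) ltac:(lia); move: (n.+1) => {leK lt_n}n IHK.
rewrite big_nat_recl //= expn1 digsumE //.
under eq_bigr => i _ do rewrite expnS divnMA.
rewrite mulnDr {5}(divn_eq n p); move: IHK; set S := _ * \sum_(_ <= _ < _) _.
have : n %/ p * p = n %/ p + n %/ p * p.-1.
  by rewrite -mulnS prednK // ltnW.
lia.
Qed.

(** Kummer's theorem in digit sum form, from Legendre's formula for the three factorials. *)
Lemma digsum_bin p n a : prime p -> a <= n ->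
  digsum p a + digsum p (n - a) = digsum p n + p.-1 * logn p 'C(n, a).
Proof.
move=> p_pr le_an; have := bin_fact le_an.
move/(congr1 (logn p)); rewrite !lognM ?muln_gt0 ?fact_gt0 ?bin_gt0 //.
move=> E; have := legendre_digsum n p_pr; rewrite -E !mulnDr.
have := legendre_digsum a p_pr; have := legendre_digsum (n - a) p_pr; lia.
Qed.

(** * Lifting a finite field to characteristic zero *)

Local Open Scope ring_scope.

Lemma finField_prim_root (F : finFieldType) : exists a : F, (#|F|.-1).-primitive_root a.
Proof.
have F1 := finNzRing_gt1 F.
pose rs := enum [pred x : F | x != 0].
have : has (#|F|.-1).-primitive_root rs.
  apply: has_prim_root; rewrite ?enum_uniq //; first by rewrite -subn1 subn_gt0.
    apply/allP => x; rewrite mem_enum inE => x0.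
    apply/unity_rootP; apply: (mulfI x0).
    by rewrite -exprS prednK ?expf_card ?mulr1 // ltnW.
  by rewrite -cardE cardC1.
by case/hasP => a _ a_prim; exists a.
Qed.

(* [J n] plays the role of the ideal [p ^ n R]. *)
Record unramified_lift (p : nat) (F : fieldType) (R : comNzRingType)
    (red : R -> F) (J : nat -> R -> Prop) : Prop := UnramifiedLift {
  lift_surj : forall x, exists u, red u = x;
  lift_full : forall u, J 0 u;
  liftD : forall n u v, J n u -> J n v -> J n (u + v);
  liftM : forall a b u v, J a u -> J b v -> J (a + b)%N (u * v);
  liftS : forall n u, J n.+1 u -> J n u;
  lift_pX : forall n, J n (p ^ n)%:R;
  lift_ker : forall u, red u = 0 -> J 1 u;
  lift_nat : forall n c, J n c%:R -> (p ^ n %| c)%N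
}.

(* [J n] is the ideal [(p ^ n, h)] of [{poly int}], where [h] is monic and reduces
   modulo [p] to the minimal polynomial of a primitive root [a] of [F]. *)
Lemma exists_unramified_lift (F : finFieldType) (p : nat) : p \in [pchar F] ->
  exists (red : {rmorphism {poly int} -> F}) (J : nat -> {poly int} -> Prop),
    unramified_lift p red J.
Proof.
move=> pcharFp; have p_pr := pcharf_prime pcharFp.
have [a a_prim] := finField_prim_root F.
have Fp0 (x : int) : x%:~R = 0 :> 'F_p -> (p %| x)%Z.
  have charp : p \in [pchar 'F_p] by apply: pchar_Fp.
  case: (intP x) => [|n|n]; rewrite ?dvdz0 ?dvdzN ?mulrNz //.
    by rewrite -pmulrn => /eqP; rewrite -(dvdn_pcharf charp).
  by move/eqP; rewrite oppr_eq0 -pmulrn -(dvdn_pcharf charp).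
pose L : splittingFieldType 'F_p := pPrimeCharType pcharFp.
pose aL : L := a.
have [g g_min] : exists g, minPoly 1 aL = map_poly (in_alg L) g.
  by apply/polyOver1P; apply: minPolyOver.
have g_monic : g \is monic.
  by have := monic_minPoly 1 aL; rewrite g_min map_monic.
have g_dvd (P : {poly int}) : (map_poly intr P : {poly F}).[a] = 0 ->
    (g %| map_poly intr P)%R.
  move=> Pa; rewrite -(dvdp_map (in_alg L)) -g_min minPoly_dvdp //.
    by apply/polyOver1P; exists (map_poly intr P).
  rewrite -map_poly_comp; apply/rootP; rewrite -[RHS]Pa.
  by congr (horner _ _); apply: eq_map_poly => x; rewrite /= -in_algE rmorph_int.
pose lift (x : 'F_p) : int := Posz x.
have liftK x : (lift x)%:~R = x by rewrite /lift -pmulrn natr_Zp.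
have lift0 : lift 0 = 0 by [].
have map_liftK (P : {poly 'F_p}) : map_poly intr (map_poly lift P) = P.
  by apply/polyP=> i; rewrite coef_map coef_map_id0 // [LHS]liftK.
pose h := map_poly lift g.
have h_size : size h = size g.
  by apply: size_map_poly_id0; rewrite (monicP g_monic).
have h_monic : h \is monic.
  by rewrite monicE lead_coef_map_id0 ?(monicP g_monic).
(* As [h] is not constant, integers are their own remainders modulo [h]; [lift_nat] rests on
   this. *)
have h1 : (1 < size h)%N.
  rewrite h_size -(size_map_poly (in_alg L)) -g_min size_minPoly ltnS.
  by rewrite adjoin_degreeE divn_gt0 ?adim_gt0 // dimvS // subv_adjoin.
pose red : {rmorphism {poly int} -> F} := horner_eval a \o map_poly intr.
exists red, (fun n u => exists s t, u = (p ^ n)%:R * s + h * t); split.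
- move=> x; have [->|x0] := eqVneq x 0; first by exists 0; rewrite rmorph0.
  have xX : x ^+ #|F|.-1 = 1.
    apply: (mulfI x0); have F1 := finNzRing_gt1 F.
    by rewrite -exprS prednK ?expf_card ?mulr1 // ltnW.
  have [i ->] := prim_rootP a_prim xX; exists ('X^i).
  by rewrite /red /= map_polyXn /horner_eval hornerXn.
- by move=> u; exists u, 0; rewrite mul1r mulr0 addr0.
- move=> n _ _ [s [t ->]] [s' [t' ->]]; exists (s + s'), (t + t').
  by rewrite !mulrDr addrACA.
- move=> k l _ _ [s [t ->]] [s' [t' ->]].
  exists (s * s'), ((p ^ k)%:R * s * t' + t * ((p ^ l)%:R * s' + h * t')).
  by rewrite expnD natrM; ring.
- move=> n _ [s [t ->]]; exists (p%:R * s), t.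
  by rewrite mulrA -natrM expnSr.
- by move=> n; exists 1, 0; rewrite mulr1 mulr0 addr0.
(* After subtraction of a multiple of [h], all coefficients of [P] vanish modulo [p] and can be
   divided by [p]. *)
- move=> P /g_dvd/dvdpP[t Pt].
  have : map_poly intr (P - h * map_poly lift t) = 0 :> {poly 'F_p}.
    by rewrite rmorphB rmorphM /= !map_liftK Pt mulrC subrr.
  move: (P - _) (subrK (h * map_poly lift t) P) => D <- D0.
  exists (map_poly (fun x => (x %/ p)%Z) D), (map_poly lift t); congr (_ + _).
  rewrite -polyC_natr mul_polyC; apply/polyP=> i.
  rewrite coefZ coef_map_id0 ?div0z // expn1 -mulrC mulr_natr -mulr_natr.
  rewrite natz divzK //; apply: Fp0.
  by have := congr1 (fun P : {poly 'F_p} => P`_i) D0; rewrite coef_map coef0.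
(* Taking remainders modulo [h] removes the [h]-part; the constant coefficient then shows [c] as a
   multiple of [p ^ n]. *)
- move=> n c [s [t E]].
  have := congr1 (fun P : {poly int} => (Pdiv.CommonRing.rmodp P h)`_0) E.
  rewrite Pdiv.RingMonic.rmodpD // [h * t]mulrC Pdiv.RingMonic.rmodp_mull // addr0.
  rewrite -!polyC_natr mul_polyC Pdiv.RingMonic.rmodpZ // coefZ.
  rewrite Pdiv.CommonRing.rmodp_small; last exact: leq_ltn_trans (size_polyC_leq1 _) h1.
  rewrite coefC eqxx !natz => e_c.
  suff: (Posz (p ^ n)%N %| Posz c)%Z by [].
  by apply/dvdzP; exists (Pdiv.CommonRing.rmodp s h)`_0; rewrite e_c mulrC.
Qed.

(** * The trace and the equation y^q - y = c *)

Lemma card_roots_lt (F : finFieldType) (P : {poly F}) :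
  P != 0 -> (#|[set x | root P x]| < size P)%N.
Proof.
move=> P0; rewrite cardE; apply: max_poly_roots; rewrite ?enum_uniq //.
by apply/allP => x; rewrite mem_enum inE.
Qed.

Section Trace.

Variables (F : finFieldType) (p e m : nat).
Hypotheses (pcharFp : p \in [pchar F]) (e_gt0 : (0 < e)%N) (m_gt0 : (0 < m)%N).
Let q := (p ^ e)%N.
Hypothesis cardF : #|F| = (q ^ m)%N.

Definition trace (x : F) : F := \sum_(l < m) x ^+ (q ^ l).

Let p_pr : prime p. Proof. exact: pcharf_prime pcharFp. Qed.
Let q_gt1 : (1 < q)%N.
Proof. by rewrite /q -[1%N](exp1n e) ltn_exp2r // prime_gt1. Qed.

Let pchar_nat l : [pchar F].-nat (q ^ l)%N.
Proof. by rewrite !pnatX pnatE // pcharFp. Qed.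

Lemma expX_sum l (I : Type) (r : seq I) (E : I -> F) :
  (\sum_(i <- r) E i) ^+ (q ^ l) = \sum_(i <- r) E i ^+ (q ^ l).
Proof.
elim/big_rec2: _ => [|i _ y _ <-]; last by rewrite exprDn_pchar.
by rewrite expr0n expn_eq0 gtn_eqF // ltnW.
Qed.

(** The [q]-th power permutes the [m] conjugates cyclically, as [x ^+ (q ^ m) = x]. *)
Lemma trace_expq x : trace x ^+ q = trace x.
Proof.
have /= qD := @expX_sum 1%N 'I_m (index_enum _).
rewrite expn1 in qD; rewrite /trace qD; case: m m_gt0 cardF => // m' _ cF.
rewrite big_ord_recr big_ord_recl /= -exprM -expnSr -cF expf_card expn0 expr1.
by rewrite addrC; congr (_ + _); apply: eq_bigr => i _; rewrite -exprM -expnSr.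
Qed.

Lemma trace_artin_schreier y : trace (y ^+ q - y) = 0.
Proof.
rewrite /trace (eq_bigr (fun l : 'I_m => y ^+ (q ^ l.+1) - y ^+ (q ^ l))).
  rewrite -(big_mkord xpredT (fun l => y ^+ (q ^ l.+1) - y ^+ (q ^ l))).
  by rewrite telescope_sumr // -cardF expf_card expn0 expr1 subrr.
by move=> l _; rewrite exprDn_pchar // exprNn_pchar // -exprM -expnS.
Qed.

Lemma card_trace0 : (#|[set c | trace c == 0%R]| <= q ^ m.-1)%N.
Proof.
pose P : {poly F} := \sum_(l < m) 'X^(q ^ l).
have szP : size P = (q ^ m.-1).+1.
  rewrite /P; case: m m_gt0 => // m' _; rewrite big_ord_recr /=.
  rewrite addrC size_polyDl size_polyXn // ltnS.
  apply: leq_trans (size_sum _ _ _) _; apply/bigmax_leqP => i _.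
  by rewrite size_polyXn ltn_exp2l.
have P0 : P != 0 by rewrite -size_poly_eq0 szP.
have := card_roots_lt P0; rewrite szP ltnS; congr (_ <= _)%N; apply: eq_card => c.
by rewrite !inE rootE horner_sum; congr (_ == 0); apply: eq_bigr => l _; rewrite hornerXn.
Qed.

Lemma card_artin_schreier_leq c : (#|[set y : F | (y ^+ q - y == c)%R]| <= q)%N.
Proof.
pose P : {poly F} := 'X^q - ('X + c%:P).
have szP : size P = q.+1.
  by rewrite size_polyDl size_polyXn // size_polyN size_XaddC.
have P0 : P != 0 by rewrite -size_poly_eq0 szP.
have := card_roots_lt P0; rewrite szP ltnS; congr (_ <= _)%N; apply: eq_card => y.
by rewrite !inE rootE !hornerE opprD addrA subr_eq0.
Qed.

(* The upper bounds on the fibres and on the trace zero elements are forced to be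
   equalities by [#|F| = q * q ^ m.-1]. *)
Lemma card_artin_schreier c :
  #|[set y : F | y ^+ q - y == c]| = if trace c == 0 then q else 0%N.
Proof.
case: ifPn => [c0|cN0]; last first.
  apply/eqP; rewrite cards_eq0 -subset0; apply/subsetP => y; rewrite !inE.
  by move/eqP=> yc; rewrite -yc trace_artin_schreier eqxx in cN0.
apply/eqP; rewrite eqn_leq card_artin_schreier_leq leqNgt; apply/negP => lt_q.
have : (#|F| < q * q ^ m.-1)%N; last by rewrite cardF -expnS prednK // ltnn.
have -> : #|F| = (\sum_(d in [set c | trace c == 0%R]) #|[set y : F | (y ^+ q - y == d)%R]|)%N.
  rewrite -cardsT -sum1_card (partition_big (fun y : F => y ^+ q - y) (mem [set c | trace c == 0])) /=.
    by apply: eq_bigr => d _; rewrite -sum1_card; apply: eq_bigl => y; rewrite !inE.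
  by move=> y _; rewrite inE trace_artin_schreier.
apply: leq_trans (_ : #|[set c | trace c == 0%R]| * q <= _)%N; last first.
  by rewrite mulnC leq_mul2l card_trace0 orbT.
rewrite -sum_nat_const (bigD1 c) ?inE //= [X in (_ < X)%N](bigD1 c) ?inE //=.
by rewrite -addSn leq_add //; apply: leq_sum => d _; apply: card_artin_schreier_leq.
Qed.

Lemma Nsol_trace k (f : {mpoly F[k]}) :
  Nsol q f = (q * #|[set x : {ffun 'I_k -> F} | trace f.@[x] == 0%R]|)%N.
Proof.
rewrite /Nsol -sum1_card (partition_big (fun xy : {ffun 'I_k -> F} * F => xy.1) xpredT) //=.
rewrite mulnC -sum_nat_const big_mkcond [RHS]big_mkcond /=; apply: eq_bigr => x _.
rewrite inE -card_artin_schreier -sum1_card.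
rewrite (reindex_onto (fun y => (x, y)) snd) /=; last by case=> x' y /= /andP[_ /eqP->].
by apply: eq_bigl => y; rewrite !inE /= !eqxx !andbT eq_sym.
Qed.

End Trace.

(** * Teichmuller representatives *)

Section UnramifiedLift.

Variables (p : nat) (F : finFieldType) (R : comNzRingType).
Variables (red : {rmorphism R -> F}) (J : nat -> R -> Prop).
Hypotheses (pcharFp : p \in [pchar F]) (JP : unramified_lift p red J).

Lemma liftMl k u v : J k v -> J k (u * v).
Proof. by move=> Jv; apply: (liftM JP) (lift_full JP u) Jv. Qed.

Lemma lift_dvdn k c : (p ^ k %| c)%N -> J k c%:R.
Proof. by case/dvdnP=> d ->; rewrite natrM; apply/liftMl/(lift_pX JP). Qed.

Lemma lift_zero k : J k 0.
Proof. exact: (@lift_dvdn k 0). Qed.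

Lemma liftB k u v : J k u -> J k v -> J k (u - v).
Proof. by move=> Ju Jv; rewrite -mulN1r; apply: (liftD JP) Ju (liftMl _ Jv). Qed.

Lemma lift_leq a b u : (a <= b)%N -> J b u -> J a u.
Proof.
move=> /subnK <-; elim: (b - a)%N => // k IHn Ju.
exact/IHn/(liftS JP).
Qed.

Lemma lift_sum k (X : Type) (r : seq X) (P : pred X) (E : X -> R) :
  (forall x, P x -> J k (E x)) -> J k (\sum_(x <- r | P x) E x).
Proof. by move=> JE; apply: (big_ind (J k)) => //; [apply: lift_zero | apply: liftD JP _]. Qed.

Lemma lift_prod (X : Type) (r : seq X) (k : X -> nat) (E : X -> R) :
  (forall x, J (k x) (E x)) -> J (\sum_(x <- r) k x) (\prod_(x <- r) E x).
Proof.
move=> JE; elim/big_rec2: _ => [|x a y _ Jy]; first exact: lift_full JP _.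
exact: (liftM JP) (JE x) Jy.
Qed.

(** The cofactor of [u - v] is a sum of [p] terms that all reduce to [red v ^+ p.-1], so it reduces
    to 0 and gains one power of [p]. *)
Lemma lift_expp k u v : red u = red v -> J k (u - v) -> J k.+1 (u ^+ p - v ^+ p).
Proof.
move=> uv Juv; rewrite subrXX mulrC -add1n; apply: (liftM JP) Juv.
apply: (lift_ker JP); rewrite rmorph_sum /=.
rewrite (eq_bigr (fun=> red v ^+ p.-1)) => [|i _].
  by rewrite sumr_const card_ord -mulr_natr (pcharf0 pcharFp) mulr0.
rewrite rmorphM !rmorphXn uv /= -exprD subnK //.
by have := ltn_ord i; lia.
Qed.

Lemma lift_exppX L u v : red u = red v -> J L.+1 (u ^+ (p ^ L) - v ^+ (p ^ L)).
Proof.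
move=> uv; elim: L => [|L IHL].
  by rewrite !expr1; apply: (lift_ker JP); rewrite rmorphB uv subrr.
by rewrite expnSr !exprM; apply: lift_expp; rewrite ?rmorphXn ?uv.
Qed.

Lemma exists_teichmuller n B : (0 < n)%N -> #|F| = (p ^ n)%N -> exists T : F -> R,
  (forall x, red (T x) = x) /\ (forall x y, J B (T (x * y) - T x * T y)).
Proof.
move=> n_gt0 cardF; have [s redK] : exists s : F -> R, forall x, red (s x) = x.
  exact: fin_all_exists (lift_surj JP).
(* A high enough Frobenius power of any section forgets the choice of representatives modulo
   [J B]. *)
exists (fun x => s x ^+ (#|F| ^ B)); split=> [x|x y].
  rewrite rmorphXn /= redK; elim: B => // B IHB.
  by rewrite expnS exprM expf_card.
rewrite -exprMn cardF -expnM; apply: lift_leq (lift_exppX _ _).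
  by rewrite leqW // leq_pmull.
by rewrite rmorphM /= !redK.
Qed.

(** The hypothesis makes [u ^+ q.-1] reduce to 0 or 1; the [p ^ B]-th power lifts this congruence to
    [J B]. *)
Lemma lift_expp_indicator q u B : (1 < q)%N -> red u ^+ q = red u ->
  J B ((u ^+ (q.-1 * p ^ B)) - (red u != 0)%:R).
Proof.
move=> q1 uq; apply: (liftS JP).
have p_gt0 : (0 < p)%N by apply: prime_gt0; apply: pcharf_prime pcharFp.
have [u0|u0] /= := eqVneq (red u) 0.
  rewrite mulnC exprM subr0.
  have -> : (u ^+ (p ^ B)) ^+ q.-1 = (u ^+ (p ^ B)) ^+ q.-2 * (u ^+ (p ^ B) - 0 ^+ (p ^ B)).
    rewrite [0 ^+ _]expr0n expn_eq0 gtn_eqF // subr0 -exprSr.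
    by congr (_ ^+ _); case: q q1 {uq} => [|[]].
  by apply/liftMl/lift_exppX; rewrite u0 rmorph0.
rewrite exprM -[X in _ - X](expr1n _ (p ^ B)); apply: lift_exppX.
by rewrite rmorphXn rmorph1; apply: (mulfI u0); rewrite mulr1 -exprS prednK // ltnW.
Qed.

Section Teichmuller.

Variables (B : nat) (T : F -> R).
Hypotheses (redT : forall x, red (T x) = x).
Hypotheses (TM : forall x y, J B (T (x * y) - T x * T y)).

Lemma lift_expB u v l : J B (u - v) -> J B (u ^+ l - v ^+ l).
Proof. by move=> Juv; rewrite subrXX mulrC; apply: liftMl. Qed.

(* Multiplying by [T a] permutes the summands, for a primitive root [a], and
   [T a ^+ E - 1] is invertible modulo [J 1]. *)
Lemma lift_power_sum E : ~~ (#|F|.-1 %| E)%N -> J B (\sum_x T x ^+ E).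
Proof.
have [a a_prim] := finField_prim_root F => ndvd.
have a0 : a != 0.
  apply/eqP => a0; have /eqP := prim_expr_order a_prim.
  by rewrite a0 expr0n (gtn_eqF (prim_order_gt0 a_prim)) eq_sym oner_eq0.
set S := \sum_x _; pose w := T a ^+ E - 1.
have JwS : J B (w * S).
  rewrite mulrBl mul1r {2}/S (reindex_inj (mulfI a0)) /= mulr_sumr -sumrB.
  apply: lift_sum => x _; rewrite -exprMn -opprB -mulN1r; apply: liftMl.
  exact: lift_expB.
have redw : red w != 0.
  by rewrite rmorphB rmorphXn rmorph1 /= redT subr_eq0 -(prim_order_dvd a_prim).
have [v redv] := lift_surj JP (red w)^-1.
have Jwv : J B (1 - (v * w) ^+ (p ^ B)).
  apply: (liftS JP); rewrite -[X in X - _](expr1n _ (p ^ B)); apply: lift_exppX.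
  by rewrite rmorph1 rmorphM /= redv mulVf.
have pB : (0 < p ^ B)%N by rewrite expn_gt0 prime_gt0 // (pcharf_prime pcharFp).
(* The power of [v * w] is 1 modulo [J B] and has [w] as a factor, so [S] inherits membership from
   [w * S]. *)
have -> : S = S * (1 - (v * w) ^+ (p ^ B)) + (v * w) ^+ (p ^ B).-1 * v * (w * S).
  rewrite -{1}(prednK pB) exprSr; ring.
by apply: (liftD JP); apply: liftMl.
Qed.

End Teichmuller.

End UnramifiedLift.

(** * Valuation of the terms of the expansion *)

Local Open Scope nat_scope.

Lemma ceil_div_leq a b y : 0 < b -> a <= b * y -> ceil_div a b <= y.
Proof.
move=> b0 le_a; rewrite /ceil_div -ltnS ltn_divLR //; rewrite mulSn mulnC; lia.
Qed.

(** The digit weight of the exponents [E c] is bounded below by divisibility and above through the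
    [t i]. A vanishing [E c] escapes the lower bound; the [e * m] term pays for it, being the
    valuation of a sum of [#|F|] ones. *)
Lemma digit_weight_bound (p e m k W K : nat) (I : finType) (j : I -> nat)
    (t : I -> 'I_k -> nat) (E := fun c => \sum_i j i * t i c) :
    let q := p ^ e in
    1 < p -> 0 < e -> 0 < m -> 0 < W ->
    (forall i, \sum_c digsum q (t i c) <= W) ->
    \sum_i j i = q.-1 * K -> (forall c, (q ^ m).-1 %| E c) ->
  p.-1 * (e * ceil_div (m * k) W) <=
    \sum_i digsum p (j i) + p.-1 * (e * m * #|[set c | E c == 0]|).
Proof.
move=> q p1 e0 m0 W0 tW sum_j dvdE.
have q1 : 1 < q by rewrite /q -[1](exp1n e) ltn_exp2r.
set k0 := #|_|.
(* This makes [Y r] an exact quotient; its integrality yields the ceiling. *)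
have dvdX r : q.-1 %| \sum_i digsum q (p ^ r * j i).
  apply/eqP; have: \sum_i digsum q (p ^ r * j i) = \sum_i p ^ r * j i %[mod q.-1].
    elim/big_rec2: _ => // i x y _ xy.
    by rewrite -modnDm digsum_modn // xy modnDm.
  by rewrite -big_distrr /= sum_j mulnCA modnMr => ->.
pose Y r := (\sum_i digsum q (p ^ r * j i)) %/ q.-1.
have leY r : ceil_div (m * k) W <= Y r + m * k0.
  apply: ceil_div_leq => //; rewrite -(@leq_pmul2r q.-1); last by lia.
  (* The [k0] vanishing exponents cost [m * k0], at most [W * (m * k0)]; each other one has digit
     sum at least [m * q.-1]. *)
  have -> : k = k0 + #|~: [set c | E c == 0]| by rewrite cardsC card_ord.
  rewrite !mulnDr !mulnDl addnC leq_add //; last first.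
    by rewrite mulnA leq_mul2r leq_mul2r leq_pmull ?orbT.
  rewrite -(mulnA W) divnK //.
  apply: (@leq_trans (\sum_c digsum q (p ^ r * E c))).
    rewrite mulnAC mulnC -sum_nat_const [X in X <= _]big_mkcond leq_sum //= => c _.
    case: ifP => //; rewrite !inE => E0.
    by rewrite leq_digsum_dvdn ?dvdn_mull // muln_gt0 expn_gt0 (ltnW p1) /= lt0n.
  rewrite big_distrr /=.
  apply: (@leq_trans (\sum_c \sum_i digsum q (p ^ r * j i) * digsum q (t i c))).
    apply: leq_sum => c _; rewrite big_distrr /=; apply: leq_trans (digsum_sum _ _ q1) _.
    by apply: leq_sum => i _; rewrite mulnA digsumM.
  rewrite exchange_big /=; apply: leq_sum => i _.
  by rewrite -big_distrr /= mulnC leq_mul2r tW orbT.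
have sumY : p.-1 * (\sum_(r < e) Y r) <= \sum_i digsum p (j i).
  rewrite -(@leq_pmul2r q.-1); last by lia.
  rewrite -mulnA big_distrl /=; under eq_bigr => r _ do rewrite divnK //.
  rewrite exchange_big big_distrr /= big_distrl /=; apply: leq_sum => i _.
  by rewrite [X in _ <= X]mulnC sum_digsum_shift.
apply: leq_trans (leq_add sumY (leqnn _)); rewrite -mulnDr leq_mul2l; apply/orP; right.
have sum_const x : e * x = \sum_(r < e) x by rewrite sum_nat_const card_ord.
by rewrite -mulnA !sum_const -big_split /=; apply: leq_sum.
Qed.

Local Open Scope ring_scope.

(* Multinomial theorem, retaining only a lower bound on the valuation of the
   multinomial coefficients [c]; [D] will be membership in [J b]. *)
Lemma sum_expr_ind (p : nat) (R : comNzRingType) (X : finType) (I : eqType)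
    (D : R -> Prop) (M : I -> X -> R) (r : seq I) (N : nat) (H : X -> R) :
  prime p -> D 0 -> (forall u v, D u -> D v -> D (u + v)) -> uniq r ->
  (forall (j : I -> nat) c v, (\sum_(i <- r) j i = N)%N -> (p ^ v %| c)%N ->
      (\sum_(i <- r) digsum p (j i) <= p.-1 * v + digsum p N)%N ->
    D (\sum_x H x * c%:R * \prod_(i <- r) M i x ^+ j i)) ->
  D (\sum_x H x * (\sum_(i <- r) M i x) ^+ N).
Proof.
move=> p_pr D0 DD; elim: r N H => [|i r IHr] N H.
  move=> _ DH; case: N DH => [|N] DH; last first.
    by rewrite big1 // => x _; rewrite big_nil expr0n mulr0.
  have := DH (fun=> 0%N) 1%N 0%N; rewrite !big_nil => /(_ erefl isT isT).
  by congr D; apply: eq_bigr => x _; rewrite !big_nil mulr1.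
move=> /andP[ir r_uniq] DH.
(* The binomial theorem splits off [i]; its factors are absorbed into [H], which is arbitrary for
   this purpose. *)
under eq_bigr => x _ do rewrite big_cons addrC exprDn mulr_sumr.
rewrite exchange_big; apply: (big_ind D) => // a _.
rewrite (eq_bigr (fun x => (H x * M i x ^+ a *+ 'C(N, a)) * (\sum_(i0 <- r) M i0 x) ^+ (N - a))); last first.
  by move=> x _; rewrite mulrnAr mulrnAl [X in H x * X]mulrC mulrA.
have le_aN : (a <= N)%N by rewrite -ltnS ltn_ord.
apply: IHr => // j c v sum_j dvd_c le_v.
pose j' y := if y == i then a : nat else j y.
have j'r (T : Type) (idx : T) (op : T -> T -> T) (G : I -> nat -> T) :
    \big[op/idx]_(y <- r) G y (j' y) = \big[op/idx]_(y <- r) G y (j y).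
  apply: eq_big_seq => y yr; rewrite /j'; case: eqP => // yi.
  by rewrite -yi yr in ir.
have := DH j' ('C(N, a) * c)%N (logn p 'C(N, a) + v)%N.
rewrite !big_cons (j'r _ _ _ (fun _ y => y)) (j'r _ _ _ (fun _ y => digsum p y)).
rewrite {1 2}/j' eqxx sum_j subnKC // => /(_ erefl).
rewrite expnD dvdn_mul ?pfactor_dvdnn // => /(_ isT).
(* The valuation of ['C(N, a)] is exactly the digit sum gained in splitting [N], up to the factor
   [p.-1]. *)
have bin_v := digsum_bin p_pr le_aN.
have -> : (digsum p a + \sum_(y <- r) digsum p (j y)
            <= p.-1 * (logn p 'C(N, a) + v) + digsum p N)%N by lia.
move=> /(_ isT); congr D; apply: eq_bigr => x _.
rewrite big_cons (j'r _ _ _ (fun y l => M y x ^+ l)) /j' eqxx natrM -[H x * _ *+ _]mulr_natr.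
by rewrite -!mulrA; congr (_ * _); rewrite [RHS]mulrCA; congr (_ * _); rewrite mulrCA.
Qed.

(** * Divisibility of the number of trace zeros *)

Lemma ceil_div_le a b : (0 < b)%N -> (ceil_div a b <= a)%N.
Proof. by move=> b0; apply: ceil_div_leq => //; rewrite leq_pmull. Qed.

(** The exponent has [.-1] because one more factor [p ^ e] comes from the fibres of [y ^+ q - y]. *)
Lemma dvdn_card_trace0 (F : finFieldType) (R : comNzRingType)
    (red : {rmorphism R -> F}) (J : nat -> R -> Prop) (p e m k s W : nat)
    (a : 'I_s -> F) (w : 'I_s -> 'I_k -> nat) :
    p \in [pchar F] -> unramified_lift p red J -> (0 < e)%N -> (0 < m)%N -> (0 < W)%N ->
    #|F| = ((p ^ e) ^ m)%N ->
    (forall i, \sum_c digsum (p ^ e) (w i c) <= W)%N ->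
  (p ^ (e * (ceil_div (m * k) W).-1) %|
    #|[set x : {ffun 'I_k -> F} |
        (trace p e m (\sum_i a i * \prod_c x c ^+ w i c) == 0)%R]|)%N.
Proof.
move=> pcharFp JP e0 m0 W0 cardF wW; set b := (e * _)%N; set q := (p ^ e)%N.
have p_pr := pcharf_prime pcharFp; have p1 := prime_gt1 p_pr.
have q1 : (1 < q)%N by rewrite /q -[1%N](exp1n e) ltn_exp2r.
have cardF' : #|F| = (p ^ (e * m))%N by rewrite cardF expnM.
have em0 : (0 < e * m)%N by rewrite muln_gt0 e0.
have [T [redT TM]] := exists_teichmuller pcharFp JP b em0 cardF'.
have [A redA] : exists A : 'I_s -> R, forall i, red (A i) = a i.
  by apply: (@fin_all_exists _ (fun=> _) (fun i u => red u = a i)) => i; apply: (lift_surj JP).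
(* Raising a monomial to the power [q ^ l] only shifts the base-[q] digits of its exponents. *)
pose t (il : 'I_s * 'I_m) c := (w il.1 c * q ^ il.2)%N.
pose M (il : 'I_s * 'I_m) (x : {ffun 'I_k -> F}) :=
  A il.1 ^+ (q ^ il.2) * \prod_c T (x c) ^+ t il c.
pose f (x : {ffun 'I_k -> F}) := \sum_i a i * \prod_c x c ^+ w i c.
have redG x : red (\sum_il M il x) = trace p e m (f x).
  rewrite rmorph_sum /trace -/q /=.
  under [RHS]eq_bigr => l _ do rewrite (expX_sum pcharFp e0).
  rewrite exchange_big pair_bigA /=; apply: eq_bigr => -[i l] _ /=.
  rewrite /M /= rmorphM rmorphXn /= redA exprMn; congr (_ * _).
  rewrite rmorph_prod -prodrXl; apply: eq_bigr => c _.
  by rewrite rmorphXn /= redT /t -exprM.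
apply: (lift_nat JP).
have GN x : J b ((\sum_il M il x) ^+ (q.-1 * p ^ b) - (trace p e m (f x) != 0)%:R).
  rewrite -redG; apply: (lift_expp_indicator pcharFp JP) => //.
  by rewrite redG (trace_expq pcharFp e0 m0 cardF).
have sumGN : J b (\sum_x 1 * (\sum_il M il x) ^+ (q.-1 * p ^ b)).
  apply: (sum_expr_ind p_pr); [exact: (lift_zero JP)|exact: (liftD JP)|exact: index_enum_uniq|].
  move=> j c v sum_j dvd_c le_v.
  pose E d := (\sum_il j il * t il d)%N.
  have prodM x : \prod_il M il x ^+ j il =
      \prod_(il : 'I_s * 'I_m) A il.1 ^+ (q ^ il.2 * j il) * \prod_d T (x d) ^+ E d.
    under eq_bigr => il _ do rewrite exprMn -exprM -prodrXl.
    rewrite big_split exchange_big /=; congr (_ * _); apply: eq_bigr => d _.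
    by rewrite /E -prodrXr; apply: eq_bigr => il _; rewrite -exprM mulnC.
  under eq_bigr => x _ do rewrite mul1r prodM mulrCA.
  rewrite -mulr_sumr -mulr_sumr; apply: (liftMl JP).
  (* The sum over all points factors into one power sum per coordinate. *)
  rewrite -(bigA_distr_bigA (fun d y => T y ^+ E d)) /=.
  have [/forallP dvdE|/forallPn[d ndvd]] := boolP [forall d, (#|F|.-1 %| E d)%N]; last first.
    rewrite (bigD1 d) //= mulrCA mulrC; apply: (liftMl JP).
    exact: (lift_power_sum pcharFp JP redT TM).
  (* The coefficient [c] contributes [v], and each [d] with [E d = 0] contributes a sum of
     [#|F| = p ^ (e * m)] ones. *)
  apply: (@lift_leq _ _ _ _ _ JP _ (v + \sum_(d < k) if E d == 0%N then e * m else 0)%N).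
    have := @digit_weight_bound p e m k W (p ^ b) _ j t p1 e0 m0 W0 _ sum_j.
    rewrite -[(\sum_(d < k) _)%N]big_mkcond sum_nat_const.
    have -> : #|[pred d | E d == 0%N]| = #|[set d | E d == 0%N]| by rewrite cardsE.
    (* The exponent [q.-1 * p ^ b] has base-[p] digit sum [e * p.-1], the source of the lost [e]. *)
    move: le_v; rewrite [(q.-1 * _)%N]mulnC digsumXM // /q digsum_predX //.
    set S1 := (\sum_(i <- _) digsum _ _)%N; set k0 := #|_| => le_v bound.
    have {}bound : (p.-1 * (e * ceil_div (m * k) W) <= S1 + p.-1 * (e * m * k0))%N.
      apply: bound => [il|d]; last by rewrite -cardF dvdE.
      apply: leq_trans (wW il.1); apply: leq_sum => d _.
      by rewrite /t mulnC digsumXM.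
    have {bound} : (p.-1 * (e * ceil_div (m * k) W) <= p.-1 * (v + e + e * m * k0))%N.
      apply: leq_trans bound _; rewrite !mulnDr leq_add2r.
      by rewrite [(_ * e)%N]mulnC.
    rewrite leq_pmul2l; last by lia.
    rewrite /b; case: (ceil_div _ _) => [|z]; first by rewrite muln0.
    by rewrite mulnS /=; lia.
  apply: (liftM JP); first exact: (lift_dvdn JP).
  apply: (lift_prod JP) => d; case: ifP => [/eqP->|_]; last exact: (lift_full JP).
  by rewrite sumr_const cardF'; apply: (lift_dvdn JP).
(* The power of the lifted trace replaces the indicator of a nonzero trace, up to an error in
   [J b]. *)
have -> : #|[set x : {ffun 'I_k -> F} | trace p e m (f x) == 0]|%:R =
  \sum_(x : {ffun 'I_k -> F}) 1 - \sum_x 1 * (\sum_il M il x) ^+ (q.-1 * p ^ b)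
  + \sum_(x : {ffun 'I_k -> F}) ((\sum_il M il x) ^+ (q.-1 * p ^ b)
       - (trace p e m (f x) != 0)%:R) :> R.
  under [X in _ - X + _]eq_bigr => x _ do rewrite mul1r.
  rewrite sumrB subrKA -sumrB -sum1_card natr_sum big_mkcond; apply: eq_bigr => x _.
  by rewrite inE; case: eqP; rewrite ?subr0 ?subrr.
apply: (liftD JP); last by apply: (lift_sum JP) => x _; apply: GN.
(* There are [p ^ (e * m * k)] points, and the ceiling is at most [m * k]. *)
apply: (liftB JP) => //; rewrite sumr_const; apply: (lift_dvdn JP).
rewrite card_ffun card_ord cardF' -expnM dvdn_exp2l // /b -mulnA leq_mul2l.
by rewrite (leq_trans (leq_pred _)) ?orbT // ceil_div_le.
Qed.

(** * Reduction of exponents and conclusion *)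

Lemma expf_reduce (F : finFieldType) (t : nat) :
  exists2 r, (r < #|F|)%N && (r <= t)%N & forall x : F, x ^+ t = x ^+ r.
Proof.
have: (1 < #|F|)%N by apply: finNzRing_gt1.
move=> F1; elim/ltn_ind: t => t IHt.
have [lt_t|ge_t] := ltnP t #|F|; first by exists t; rewrite // lt_t leqnn.
(* The lowered exponent is still positive, so the identity also holds at 0. *)
have [|r /andP[rF rt] xr] := IHt (t - #|F|.-1)%N; first by lia.
exists r; first by rewrite rF (leq_trans rt) // leq_subr.
move=> x; rewrite -xr -{1}(subnK ge_t) exprD expf_card -exprSr.
by congr (_ ^+ _); lia.
Qed.

Lemma leq_Wq q Q k d (t : 'I_k -> nat) : (forall c, t c < Q)%N ->
  (\sum_c t c <= d)%N -> (\sum_c digsum q (t c) <= Wq q Q k d)%N.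
Proof.
move=> tQ le_d; pose t' : {ffun 'I_k -> 'I_Q} := [ffun c => Ordinal (tQ c)].
have t'E c : t' c = t c :> nat by rewrite ffunE.
under eq_bigr => c _ do rewrite -t'E.
by apply: (leq_bigmax_cond t'); under eq_bigr => c _ do rewrite t'E.
Qed.

Lemma Wq_gt0 q Q k d : (1 < q)%N -> (1 < Q)%N -> (0 < k)%N -> (0 < d)%N ->
  (0 < Wq q Q k d)%N.
Proof.
case: k => // k q1 Q1 _ d0; pose t (c : 'I_k.+1) : nat := c == ord0.
have sum_t : (\sum_c t c = 1)%N.
  by rewrite (bigD1 ord0) //= big1 // => c /negPf; rewrite /t => ->.
have tQ c : (t c < Q)%N by rewrite /t; case: (_ == _) => //; lia.
have := @leq_Wq q Q k.+1 d t tQ; rewrite sum_t => /(_ d0); apply: leq_trans.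
by rewrite (bigD1 ord0) //= /t eqxx digsum_small.
Qed.

Theorem theorem5p6 (p e m k : nat) (F : finFieldType) (f : {mpoly F[k]}) :
  prime p -> (1 <= e)%N -> (1 <= m)%N -> (1 <= k)%N ->
  #|F| = expn (expn p e) m ->
  (1 <= (msize f).-1)%N ->
  dvdn (expn p (e * ceil_div (m * k) (Wq (expn p e) (expn (expn p e) m) k (msize f).-1)))
       (Nsol (expn p e) f).
Proof.
move=> p_pr e0 m0 k0 cardF d0; set W := Wq _ _ _ _.
have pcharFp : p \in [pchar F].
  by apply: (@card_finPcharP _ _ (e * m)); rewrite ?expnM.
have q1 : (1 < p ^ e)%N by rewrite -[1%N](exp1n e) ltn_exp2r // prime_gt1.
have W0 : (0 < W)%N by apply: Wq_gt0; rewrite // -cardF finNzRing_gt1.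
rewrite (Nsol_trace pcharFp e0 m0 cardF).
pose mon (i : 'I_(size (msupp f))) : 'X_{1..k} := tnth (in_tuple (msupp f)) i.
pose reduced i c (r : nat) :=
  (r < #|F|)%N && (r <= mon i c)%N /\ forall x : F, x ^+ mon i c = x ^+ r.
(* Reduced exponents fall in the range of [Wq] without raising the degree, and keep the values of
   [f]. *)
have [w wP] : exists w : 'I_(size (msupp f)) -> 'I_k -> nat,
    forall i c, reduced i c (w i c).
  have exr i : exists r : 'I_k -> nat, forall c, reduced i c (r c).
    apply: (@fin_all_exists _ (fun=> nat) (fun c => reduced i c)) => c.
    by have [r ? ?] := expf_reduce F (mon i c); exists r.
  exact: (@fin_all_exists _ (fun=> 'I_k -> nat) _ exr).
have wW i : (\sum_c digsum (p ^ e) (w i c) <= W)%N.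
  apply: leq_Wq => [c|]; first by rewrite -cardF; case: (wP i c) => /andP[].
  apply: leq_trans (_ : mdeg (mon i) <= _)%N.
    by rewrite mdegE; apply: leq_sum => c _; case: (wP i c) => /andP[].
  have := @msize_mdeg_lt _ _ f (mon i) (mem_tnth _ _).
  by case: (msize f) => // d; rewrite ltnS.
have [red [J JP]] := exists_unramified_lift pcharFp.
have := dvdn_card_trace0 (fun i => f@_(mon i)) pcharFp JP e0 m0 W0 cardF wW.
set A := [set _ | _]; set B := [set _ | _] => dvdA.
have -> : B = A.
  apply/setP=> x; rewrite !inE mevalE big_tnth; congr (trace _ _ _ _ == 0).
  apply: eq_bigr => i _; congr (_ * _); apply: eq_bigr => c _.
  by case: (wP i c) => _ ->.
(* A nonzero ceiling is its predecessor, provided by the trace zeros, plus one for the factor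
   [p ^ e]. *)
case: (ceil_div _ _) dvdA => [|z] dvdA; first by rewrite muln0.
by rewrite mulnS expnD dvdn_mul.
Qed.
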